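(* Let $0\le\delta<1$, $\beta\in(0,1-\delta)$, and $w_1,\dots,w_\ell\in\mathbb{R}^n$ with $\ell=\delta n$. Consider the semidefinite program: minimize $\sum_{i=1}^n q_i$ over $\eta\in\mathbb{R}^\ell$, $q\in\mathbb{R}^n$ with $q\ge0$, and $n\times n$ positive semidefinite $G$, subject to \[ \sum_{k=1}^\ell\eta_k w_kw_k^T+G-\frac1\beta\mathrm{diag}(G)+\sum_{i=1}^n q_ie_ie_i^T\succeq I. \] Then every feasible solution has objective value at least $(1-\delta-\beta)n$; in particular its optimum value is at least $(1-\delta-\beta)n$.
   Context: $e_i$ is the $i$-th standard basis vector, $I$ the identity, $\mathrm{diag}(G)$ the diagonal part of $G$, and $\succeq$ the positive semidefinite order. *)

(* Defs.v *)
From HB Require Import structures.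
From mathcomp Require Import all_boot all_order all_algebra.
Set Implicit Arguments. Unset Strict Implicit. Unset Printing Implicit Defensive.
Import Order.TTheory GRing.Theory Num.Theory.
Local Open Scope ring_scope.

Definition psd (R : realFieldType) (n : nat) (A : 'M[R]_n) : Prop :=
  A^T = A /\ forall x : 'cV[R]_n, 0 <= (x^T *m A *m x) 0 0.

Definition loewner_ge (R : realFieldType) (n : nat) (A B : 'M[R]_n) : Prop :=
  psd (A - B).

Definition diagpart (R : realFieldType) (n : nat) (G : 'M[R]_n) : 'M[R]_n :=
  diag_mx (\row_i G i i).

Definition std_basis (R : realFieldType) (n : nat) (i : 'I_n) : 'cV[R]_n :=
  delta_mx i 0.

(* Main.v *)
(** By weak duality one would look for a large subspace that is orthogonal to the
    [w k] and on which [G <= beta^-1 diag G].  To avoid square roots and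
    eigenvalues, take [D = diag G + eps I] and grow greedily a [D]-orthogonal
    family [V] with [v G v^T >= beta^-1 v D v^T].  A Bessel inequality bounds the
    sum of the quotients [v G v^T / v D v^T] by [\sum_i G i i / D i i <= n], so
    [V] has at most [beta n] members.  Once [V] cannot be extended by a row of an
    orthogonal basis [U] of the [n - l - #|V|] dimensional space that is orthogonal
    to the [w k] and [D]-orthogonal to [V], feasibility gives
    [u u^T <= u (diag q + eps / beta I) u^T] for each such row [u], and Bessel for
    [U] gives [n - l - beta n <= \sum_i q i + n eps / beta].  Let [eps] tend to 0. *)
Require Import Defs.
From HB Require Import structures.
From mathcomp Require Import all_boot all_order all_algebra.
From mathcomp Require Import zify ring lra.
Import Order.TTheory GRing.Theory Num.Theory.
Set Implicit Arguments.
Unset Strict Implicit.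
Local Open Scope ring_scope.

(** * Quadratic forms evaluated on row vectors *)

Definition qform {R : realFieldType} {n : nat} (M : 'M[R]_n) (u : 'rV[R]_n) : R :=
  (u *m M *m u^T) 0 0.

Lemma qformD {R : realFieldType} {n : nat} (A B : 'M[R]_n) u :
  qform (A + B) u = qform A u + qform B u.
Proof. by rewrite /qform mulmxDr mulmxDl mxE. Qed.

Lemma qformZ {R : realFieldType} {n : nat} a (A : 'M[R]_n) u :
  qform (a *: A) u = a * qform A u.
Proof. by rewrite /qform -scalemxAr -scalemxAl mxE. Qed.

Lemma qformB {R : realFieldType} {n : nat} (A B : 'M[R]_n) u :
  qform (A - B) u = qform A u - qform B u.
Proof. by rewrite qformD -scaleN1r qformZ mulN1r. Qed.

Lemma psd_qform_ge0 {R : realFieldType} {n : nat} (M : 'M[R]_n) u :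
  psd M -> 0 <= qform M u.
Proof. by case=> _ /(_ u^T); rewrite trmxK. Qed.

Lemma qform_row {R : realFieldType} {n k : nat} (M : 'M[R]_n) (V : 'M[R]_(k, n)) j :
  (V *m M *m V^T) j j = qform M (row j V).
Proof.
rewrite /qform -row_mul !mxE; apply: eq_bigr => i _.
by rewrite !mxE.
Qed.

Lemma qform_diag {R : realFieldType} {n : nat} (d u : 'rV[R]_n) :
  qform (diag_mx d) u = \sum_i d 0 i * u 0 i ^+ 2.
Proof.
rewrite /qform mul_mx_diag mxE; apply: eq_bigr => i _.
by rewrite !mxE expr2; ring.
Qed.

Lemma qform_diag_gt0 {R : realFieldType} {n : nat} (d u : 'rV[R]_n) :
  (forall i, 0 < d 0 i) -> u != 0 -> 0 < qform (diag_mx d) u.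
Proof.
move=> d_gt0 /rV0Pn [i ui]; rewrite qform_diag (bigD1 i) //=.
apply: ltr_pwDl; first by rewrite mulr_gt0 ?exprn_even_gt0.
by apply: sumr_ge0 => j _; rewrite mulr_ge0 ?sqr_ge0 ?ltW.
Qed.

Lemma exists_left_kernel {F : fieldType} {n r : nat} (B : 'M[F]_(n, r)) :
  (r < n)%N -> exists2 x : 'rV[F]_n, x != 0 & x *m B = 0.
Proof.
move=> r_lt_n.
have /rowV0Pn [x /sub_kermxP xB x0] : kermx B != 0.
  rewrite -mxrank_eq0 mxrank_ker subn_eq0 -ltnNge.
  exact: leq_ltn_trans (rank_leq_col B) r_lt_n.
by exists x.
Qed.

(** * Orthogonal families for a diagonal weight, and Bessel's inequality *)

(** The squared norms [c] are recorded instead of normalised to 1, since [R] need not have square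
    roots. *)
Definition orthofam {R : realFieldType} {n k : nat} (d : 'rV[R]_n)
    (V : 'M[R]_(k, n)) (c : 'rV[R]_k) : Prop :=
  (forall j, 0 < c 0 j) /\ V *m diag_mx d *m V^T = diag_mx c.

Lemma orthofam_cat {R : realFieldType} {n k m : nat} (d : 'rV[R]_n)
    (V : 'M[R]_(k, n)) (U : 'M[R]_(m, n)) c e :
  orthofam d V c -> orthofam d U e -> U *m (diag_mx d *m V^T) = 0 ->
  orthofam d (col_mx V U) (row_mx c e).
Proof.
move=> [c_gt0 VV] [e_gt0 UU] UV; split.
  by move=> j; rewrite mxE; case: split.
have VU : V *m diag_mx d *m U^T = 0.
  apply: (can_inj (@trmxK _ _ _)).
  by rewrite !trmx_mul trmxK tr_diag_mx UV trmx0.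
by rewrite tr_col_mx mul_col_mx mul_col_row VV UU VU -mulmxA UV diag_mx_row.
Qed.

Lemma orthofam1 {R : realFieldType} {n : nat} (d x : 'rV[R]_n) :
  (forall i, 0 < d 0 i) -> x != 0 ->
  orthofam d x (const_mx (qform (diag_mx d) x)).
Proof.
move=> d_gt0 x0; split=> [j|]; first by rewrite mxE qform_diag_gt0.
by apply/matrixP => i j; rewrite !ord1 /qform !mxE eqxx mulr1n.
Qed.

(** Gram-Schmidt without projections: the next row is a nonzero left kernel vector of [B] beside
    [diag_mx d *m U^T], which has fewer than [n] columns. *)
Lemma exists_orthofam {R : realFieldType} {n r : nat} (d : 'rV[R]_n)
    (B : 'M[R]_(n, r)) (m : nat) :
  (forall i, 0 < d 0 i) -> (r + m <= n)%N ->
  exists (U : 'M[R]_(m, n)) c, orthofam d U c /\ U *m B = 0.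
Proof.
move=> d_gt0; elim: m => [|m IHm] le_n.
  exists 0, 0; split; last exact: flatmx0.
  by split=> [[]//|]; rewrite [RHS]flatmx0 [LHS]flatmx0.
have [|U [c [oU UB]]] := IHm; first lia.
have [|x x0 xK] := exists_left_kernel (row_mx B (diag_mx d *m U^T)); first lia.
move: xK; rewrite mul_mx_row -row_mx0 => /eq_row_mx [xB xU].
have oUx := orthofam_cat oU (orthofam1 d_gt0 x0) xU.
rewrite -addn1; exists (col_mx U x); eexists; split; first exact: oUx.
by rewrite mul_col_mx UB xB col_mx0.
Qed.

(* For a full family, [V^T C^-1 V = D^-1], so both sides are [\tr (D^-1 M)]. *)
Lemma full_orthofam_sum {R : realFieldType} {n k : nat} (d : 'rV[R]_n)
    (V : 'M[R]_(k, n)) c (M : 'M[R]_n) :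
  k = n -> (forall i, 0 < d 0 i) -> orthofam d V c ->
  \sum_j qform M (row j V) / c 0 j = \sum_i M i i / d 0 i.
Proof.
move=> kn; case: n / kn d V M => d V M d_gt0 [c_gt0 VV].
pose inv (a : 'rV[R]_k) := diag_mx (\row_i (a 0 i)^-1).
have invP (a : 'rV[R]_k) : (forall i, 0 < a 0 i) -> diag_mx a *m inv a = 1%:M.
  move=> a_gt0; rewrite mulmx_diag; apply/matrixP => i j; rewrite !mxE.
  by rewrite divff ?(gt_eqF (a_gt0 _)).
have tr_inv a (A : 'M[R]_k) : \tr (A *m inv a) = \sum_i A i i / a 0 i.
  by rewrite mul_mx_diag; apply: eq_bigr => i _; rewrite !mxE.
have VinvV : V^T *m inv c *m V = inv d.
  (* [V] is now square, so this right inverse is also a left inverse; cancelling [diag_mx d] then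
     gives the claim. *)
  have h : V *m (diag_mx d *m V^T *m inv c) = 1%:M by rewrite !mulmxA VV invP.
  move: (mulmx1C h) (mulmx1C (invP d d_gt0)) => {}h dK.
  by rewrite -[LHS]mul1mx -dK -[RHS]mulmx1 -h !mulmxA.
rewrite -tr_inv -VinvV mulmxA mxtrace_mulC !mulmxA tr_inv.
by apply: eq_bigr => j _; rewrite qform_row.
Qed.

(** Complete [V] to a full family, where equality holds; the added terms are nonnegative because [M]
    is. *)
Lemma bessel {R : realFieldType} {n k : nat} (d : 'rV[R]_n)
    (V : 'M[R]_(k, n)) c (M : 'M[R]_n) :
  (forall i, 0 < d 0 i) -> orthofam d V c -> psd M ->
  \sum_j qform M (row j V) / c 0 j <= \sum_i M i i / d 0 i.
Proof.
move=> d_gt0 oV psdM; have [c_gt0 VV] := oV.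
(* Otherwise some nonzero [x] has [x *m V = 0], and its form under [diag_mx c] would be both
   positive and zero. *)
have k_le_n : (k <= n)%N.
  rewrite leqNgt; apply/negP => /(exists_left_kernel V) [x x0 xV].
  have := qform_diag_gt0 c_gt0 x0.
  by rewrite /qform -VV !mulmxA xV !mul0mx mxE ltxx.
have [|U [e [oU UV]]] :=
  exists_orthofam (diag_mx d *m V^T) (m := (n - k)%N) d_gt0; first by rewrite subnKC.
have <- := full_orthofam_sum M (subnKC k_le_n) d_gt0 (orthofam_cat oV oU UV).
rewrite big_split_ord /=.
under [X in _ <= X + _]eq_bigr => j _ do rewrite rowKu row_mxEl.
rewrite lerDl; apply: sumr_ge0 => j _.
by rewrite row_mxEr divr_ge0 ?psd_qform_ge0 // ltW //; case: oU.
Qed.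

Lemma orthofam_qform {R : realFieldType} {n k : nat} (d : 'rV[R]_n)
    (V : 'M[R]_(k, n)) c j :
  orthofam d V c -> qform (diag_mx d) (row j V) = c 0 j.
Proof. by case=> _ VV; rewrite -qform_row VV mxE eqxx. Qed.

(** Serves twice: with [M = G] it limits the size of [V], with [M = diag_mx p] that of [U]. *)
Lemma bessel_bound {R : realFieldType} {n k : nat} (d : 'rV[R]_n)
    (V : 'M[R]_(k, n)) c (M : 'M[R]_n) a :
  (forall i, 0 < d 0 i) -> orthofam d V c -> psd M ->
  (forall j, a * c 0 j <= qform M (row j V)) ->
  k%:R * a <= \sum_i M i i / d 0 i.
Proof.
move=> d_gt0 oV psdM leM; apply: le_trans (bessel d_gt0 oV psdM).
rewrite mulr_natl -[X in _ *+ X]card_ord -sumr_const; apply: ler_sum => j _.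
by rewrite ler_pdivlMr //; case: oV.
Qed.

(** * The terms of the semidefinite constraint *)

Lemma psd_diag {R : realFieldType} {n : nat} (d : 'rV[R]_n) :
  (forall i, 0 <= d 0 i) -> psd (diag_mx d).
Proof.
move=> d_ge0; split=> [|x]; first exact: tr_diag_mx.
have := qform_diag d x^T; rewrite /qform trmxK => ->.
by apply: sumr_ge0 => i _; rewrite mulr_ge0 ?sqr_ge0.
Qed.

Lemma sum_std_basis {R : realFieldType} {n : nat} (q : 'I_n -> R) :
  \sum_(i < n) q i *: (std_basis R i *m (std_basis R i)^T) = diag_mx (\row_i q i).
Proof.
rewrite diag_mx_sum_delta; apply: eq_bigr => i _.
by rewrite mxE /std_basis trmx_delta mul_delta_mx.
Qed.

Lemma qform_sum_outer_eq0 {R : realFieldType} {n l : nat} (w : 'I_l -> 'cV[R]_n)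
    (eta : 'I_l -> R) (u : 'rV[R]_n) :
  (forall k, u *m w k = 0) ->
  qform (\sum_(k < l) eta k *: (w k *m (w k)^T)) u = 0.
Proof.
move=> uw; rewrite /qform mulmx_sumr big1 ?mul0mx ?mxE // => k _.
by rewrite -scalemxAr mulmxA uw mul0mx scaler0.
Qed.

Lemma sum_q_ge_eps {R : realFieldType} {n l : nat} {delta beta : R}
  {w : 'I_l -> 'cV[R]_n} {eta : 'I_l -> R} {q : 'I_n -> R} {G : 'M[R]_n} :
  0 < beta -> beta < 1 - delta -> 0 <= delta -> l%:R = delta * n%:R ->
  (forall i, 0 <= q i) -> psd G ->
  loewner_ge
     (\sum_(k < l) eta k *: (w k *m (w k)^T) + G - beta^-1 *: diagpart G
      + \sum_(i < n) q i *: (std_basis R i *m (std_basis R i)^T))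
     1%:M ->
  forall eps, 0 < eps ->
  (1 - delta - beta) * n%:R <= \sum_(i < n) q i + n%:R * (eps / beta).
Proof.
move=> beta_gt0 beta_lt delta_ge0 hl q_ge0 psdG feas eps eps_gt0.
case: leP => // lt_goal; exfalso.
(* The shift by [eps] keeps the weight positive where [G i i = 0]. *)
pose d : 'rV[R]_n := \row_i (G i i + eps).
have G_ge0 i : 0 <= G i i.
  have := psd_qform_ge0 (row i 1%:M) psdG.
  by rewrite -qform_row mul1mx trmx1 mulmx1.
have d_gt0 i : 0 < d 0 i by rewrite mxE ltr_wpDl.
have size_bound k (V : 'M[R]_(k, n)) c : orthofam d V c ->
    (forall j, beta^-1 * c 0 j <= qform G (row j V)) -> k%:R <= beta * n%:R.
  move=> oV leG; rewrite mulrC -ler_pdivrMr //.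
  apply: le_trans (bessel_bound d_gt0 oV psdG leG) _.
  rewrite -[X in _ <= X%:R]card_ord -sumr_const; apply: ler_sum => i _.
  by rewrite ler_pdivrMr // mul1r mxE lerDl ltW.
have n_ge0 : 0 <= n%:R :> R by rewrite ler0n.
(* Instead of choosing a maximal family: if the goal fails, every family can be extended, yet [n.+1]
   members exceed [beta * n]. *)
suff [V [c [oV leG]]] : exists (V : 'M[R]_(n.+1, n)) c, orthofam d V c /\
    forall j, beta^-1 * c 0 j <= qform G (row j V).
  have := size_bound _ _ _ oV leG; rewrite -natr1 => h.
  have : beta * n%:R <= 1 * n%:R by apply: ler_wpM2r => //; lra.
  lra.
elim: n.+1 => [|k [V [c [oV leG]]]].
  exists 0, 0; split; last by case.
  by split=> [[]//|]; rewrite [RHS]flatmx0 [LHS]flatmx0.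
have k_le := size_bound _ _ _ oV leG.
(* Ensures that the truncated subtraction [n - (l + k)] below is a true one. *)
have lk_le : (l + k <= n)%N.
  rewrite -(ler_nat R) natrD hl.
  have : (beta + delta) * n%:R <= 1 * n%:R by apply: ler_wpM2r => //; lra.
  lra.
pose W : 'M[R]_(n, l) := \matrix_(i, j) w j i 0.
have one_gt0 i : 0 < (const_mx 1 : 'rV[R]_n) 0 i by rewrite mxE.
(* [U] is orthogonal for the standard product, but its rows are [d]-orthogonal to those of [V]. *)
have [|U [e [oU]]] := exists_orthofam (row_mx W (diag_mx d *m V^T))
  (m := (n - (l + k))%N) one_gt0; first by rewrite subnKC.
rewrite mul_mx_row -row_mx0 => /eq_row_mx [UW UV].
have [leU|] := boolP [forall j,
    qform G (row j U) <= beta^-1 * qform (diag_mx d) (row j U)].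
  (* On a row of [U] the [w] terms vanish and [G] exceeds [beta^-1 *: diagpart G] by at most
     [eps / beta] times the identity; [p] adds this excess to [q]. *)
  pose p : 'rV[R]_n := \row_i (q i + eps / beta).
  have p_ge0 i : 0 <= p 0 i.
    by rewrite mxE addr_ge0 // divr_ge0 // ltW.
  have leM j : 1 * e 0 j <= qform (diag_mx p) (row j U).
    have uw i : row j U *m w i = 0.
      have -> : w i = col i W by apply/colP => s; rewrite !mxE.
      by rewrite colE mulmxA -row_mul UW row0 mul0mx.
    have := psd_qform_ge0 (row j U) feas.
    rewrite sum_std_basis qformB qformD qformB qformD qformZ.
    rewrite qform_sum_outer_eq0 // add0r -diag_const_mx.
    have -> : diag_mx p = diag_mx (\row_i q i) + (eps / beta) *: diag_mx (const_mx 1).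
      by apply/matrixP => a b; rewrite !mxE mulr_natr; case: (a == b);
        rewrite ?mulr1n ?mulr0n ?mulr1 ?mulr0 ?addr0.
    have dE : diag_mx d = diagpart G + eps *: diag_mx (const_mx 1).
      by apply/matrixP => a b; rewrite !mxE mulr_natr; case: (a == b);
        rewrite ?mulr1n ?mulr0n ?mulr1 ?mulr0 ?addr0.
    move/forallP/(_ j): leU.
    rewrite dE !qformD !qformZ (orthofam_qform j oU) => leU feasU.
    rewrite mul1r; lra.
  (* Counting the rows of [U] and using [k_le] contradicts [lt_goal]. *)
  have := bessel_bound one_gt0 oU (psd_diag p_ge0) leM.
  under eq_bigr => i _ do rewrite !mxE eqxx mulr1n divr1.
  rewrite big_split /= sumr_const card_ord -mulr_natl mulr1.
  rewrite natrB // natrD hl => bound.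
  lra.
(* A row of [U] violating the bound extends [V]. *)
rewrite negb_forall => /existsP [j]; rewrite -ltNge => gtG.
set x := row j U in gtG.
have x0 : x != 0.
  by apply: contraTneq gtG => ->; rewrite /qform !mul0mx !mxE mulr0 ltxx.
have xV : x *m (diag_mx d *m V^T) = 0 by rewrite -row_mul UV row0.
have oVx := orthofam_cat oV (orthofam1 d_gt0 x0) xV.
rewrite -addn1; exists (col_mx V x); eexists; split; first exact: oVx.
move=> i; rewrite -[i]splitK; case: (split i) => s /=.
  by rewrite row_mxEl rowKu.
rewrite row_mxEr rowKd mxE (_ : row s x = x) ?ltW //.
by rewrite ord1 row_id.
Qed.

Theorem theorem14 (R : realFieldType) (n l : nat) (delta beta : R)
  (w : 'I_l -> 'cV[R]_n)
  (hdelta0 : 0 <= delta) (hdelta1 : delta < 1)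
  (hbeta0 : 0 < beta) (hbeta1 : beta < 1 - delta)
  (hl : l%:R = delta * n%:R)
  (eta : 'I_l -> R) (q : 'I_n -> R) (G : 'M[R]_n)
  (hq : forall i, 0 <= q i)
  (hG : psd G)
  (hfeas : loewner_ge
     (\sum_(k < l) eta k *: (w k *m (w k)^T) + G - beta^-1 *: diagpart G
      + \sum_(i < n) q i *: (std_basis R i *m (std_basis R i)^T))
     1%:M) :
  (1 - delta - beta) * n%:R <= \sum_(i < n) q i.
Proof.
have bound := sum_q_ge_eps hbeta0 hbeta1 hdelta0 hl hq hG hfeas.
apply/ler_addgt0Pr => e e_gt0.
have n1_gt0 : 0 < n.+1%:R :> R by rewrite ltr0Sn.
(* With this [eps] the error is [e * n / n.+1 <= e]; the denominator [n.+1] also covers [n = 0]. *)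
apply: le_trans (bound (e * beta / n.+1%:R) _) _.
  by rewrite divr_gt0 ?mulr_gt0.
rewrite lerD2l mulrAC mulfK ?gt_eqF // mulrCA ger_pMr //.
by rewrite ler_pdivrMr // mul1r ler_nat.
Qed.
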